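(* Let $G\ncong K_n$ be a connected graph on $n$ vertices having $p\geq 1$ pendant vertices. Then $$m_{D^{L}(G)}[n,n+p)\leq n-p.$$ For $p=n-1$, equality holds if and only if $G\cong S_n$.
   Context: All graphs are finite, simple and connected. A pendant vertex is a vertex of degree $1$. $K_n$ is the complete graph and $S_n$ the star graph on $n$ vertices. For a connected graph $G$ with vertex set $\{v_1,\dots,v_n\}$, $d_{uv}$ is the length of a shortest path between $u$ and $v$, $D(G)=(d_{uv})$ is the distance matrix, $Tr(v)=\sum_{u\in V(G)}d_{uv}$ is the transmission of $v$, and the distance Laplacian matrix is $D^L(G)=\mathrm{diag}(Tr(v_1),\dots,Tr(v_n))-D(G)$. Its eigenvalues (all real) are the distance Laplacian eigenvalues of $G$. For an interval $I\subseteq\mathbb{R}$, $m_{D^L(G)}I$ denotes the number of distance Laplacian eigenvalues of $G$, counted with multiplicity, lying in $I$. *)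

(* Defs.v *)
From mathcomp Require Import all_boot all_order all_algebra.
From mathcomp Require Import polyrcf.

Set Implicit Arguments.
Unset Strict Implicit.
Unset Printing Implicit Defensive.

Import Order.TTheory GRing.Theory Num.Theory.
Local Open Scope ring_scope.

Record sgraph (n : nat) := SGraph {
  adj : rel 'I_n;
  adj_sym : symmetric adj;
  adj_irr : irreflexive adj
}.

Definition graph_iso (n m : nat) (G : sgraph n) (H : sgraph m) : Prop :=
  exists2 f : 'I_n -> 'I_m,
    bijective f & forall u v, adj H (f u) (f v) = adj G u v.

Definition connected (n : nat) (G : sgraph n) : Prop :=
  forall u v, connect (adj G) u v.

Definition complete_adj (n : nat) : rel 'I_n := fun u v => u != v.

Lemma complete_sym n : symmetric (@complete_adj n).
Proof. by move=> u v; rewrite /complete_adj eq_sym. Qed.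

Lemma complete_irr n : irreflexive (@complete_adj n).
Proof. by move=> u; rewrite /complete_adj eqxx. Qed.

Definition complete_graph (n : nat) : sgraph n :=
  SGraph (@complete_sym n) (@complete_irr n).

(* The centre is vertex 0: u and v are adjacent iff exactly one of them is. *)
Definition star_adj (n : nat) : rel 'I_n :=
  fun u v => (val u == 0%N) != (val v == 0%N).

Lemma star_sym n : symmetric (@star_adj n).
Proof. by move=> u v; rewrite /star_adj eq_sym. Qed.

Lemma star_irr n : irreflexive (@star_adj n).
Proof. by move=> u; rewrite /star_adj eqxx. Qed.

Definition star_graph (n : nat) : sgraph n :=
  SGraph (@star_sym n) (@star_irr n).

Section Invariants.
Variables (n : nat) (G : sgraph n).

Definition degree (v : 'I_n) : nat := #|[set u | adj G v u]|.

Definition pendant : {set 'I_n} := [set v | degree v == 1%N].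

Definition has_walk (u v : 'I_n) (k : nat) : bool :=
  [exists w : k.-tuple 'I_n, path (adj G) u w && (last u w == v)].

(* Least k < n such that a walk of length k joins u to v; the default value n
   is only taken when u and v are not connected (see gdistP). *)
Definition gdist (u v : 'I_n) : nat := find (has_walk u v) (iota 0 n).

Lemma gdistP u v : connect (adj G) u v ->
  has_walk u v (gdist u v) /\
  (forall w, path (adj G) u w -> last u w = v -> (gdist u v <= size w)%N).
Proof.
have walkP w : path (adj G) u w -> last u w = v -> has_walk u v (size w).
  move=> pw lw; apply/existsP; exists (in_tuple w).
  by rewrite /= pw lw eqxx.
case/connectP=> w0 pw0 lw0.
have [w pw [lw szw]] : exists2 w, path (adj G) u w & last u w = v /\ (size w < n)%N.
  case/shortenP: pw0 lw0 => w pw uw _ ->; exists w => //; split=> //.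
  by have := max_card [in u :: w]; rewrite card_ord (card_uniqP uw).
have hs : has (has_walk u v) (iota 0 n).
  apply/hasP; exists (size w); first by rewrite mem_iota.
  exact: walkP.
have dn : (gdist u v < n)%N by have := hs; rewrite has_find size_iota.
split; first by have := nth_find 0%N hs; rewrite -/(gdist u v) nth_iota.
move=> x px lx; rewrite leqNgt; apply/negP => lt.
have := before_find 0%N lt; rewrite nth_iota ?(ltn_trans lt dn) // add0n.
by rewrite walkP.
Qed.

Definition transmission (v : 'I_n) : nat := (\sum_(u < n) gdist u v)%N.

Definition dist_mx (R : pzRingType) : 'M[R]_n :=
  \matrix_(u, v) (gdist u v)%:R.

Definition distL_mx (R : pzRingType) : 'M[R]_n :=
  diag_mx (\row_v (transmission v)%:R) - dist_mx R.

End Invariants.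

(* Eigenvalues are the roots of the characteristic polynomial, counted with
   algebraic multiplicity; rootsR lists each root of a nonzero polynomial once. *)
Definition eig_count (R : rcfType) (n : nat) (M : 'M[R]_n) (I : interval R)
  : nat :=
  (\sum_(x <- rootsR (char_poly M) | x \in I) mup x (char_poly M))%N.

(* Main.v *)
(** Non-adjacent vertices are at distance at least 2, and the pendant vertices
    of [G <> K_n] are pairwise non-adjacent, so in the order of quadratic forms the
    distance Laplacian dominates [L(K_n) + L(K_P)], [K_P] being the clique on
    the [p] pendant vertices.  On the (p-1)-dimensional space of vectors of sum
    zero supported in [P] the right-hand side is the scalar [n + p], whence at
    least [p - 1] eigenvalues are [>= n + p]; a further one is [0 < n].  If
    [p = n - 1] then [G] is a star, and [n] is an eigenvalue since the centre
    dominates. *)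

Require Import Defs.
From mathcomp Require Import all_boot all_order all_algebra.
From mathcomp Require Import perm spectral polyrcf complex ring zify.

Set Implicit Arguments.
Unset Strict Implicit.
Unset Printing Implicit Defensive.

Import Order.TTheory GRing.Theory Num.Theory.
Local Open Scope ring_scope.
Local Open Scope sesquilinear_scope.

(** * Eigenvalue counts and the spectral theorem for real symmetric matrices *)

Lemma mup_prod_XsubC (F : fieldType) (I : finType) (r : I -> F) (x : F) :
  mup x (\prod_i ('X - (r i)%:P)) = (\sum_i (r i == x))%N.
Proof.
have [_ ->] : \prod_i ('X - (r i)%:P) != 0 /\
    mup x (\prod_i ('X - (r i)%:P)) = (\sum_i (r i == x))%N; last by [].
elim/big_rec2: _ => [|i m p _ [p0 mp]].
  by split; [exact: oner_neq0 | rewrite mupNroot // rootC oner_eq0].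
split; first by rewrite mulf_neq0 // polyXsubC_eq0.
rewrite mupM ?polyXsubC_eq0 // mp; congr (_ + _)%N.
by have := mup_XsubCX 1 x (r i); rewrite expr1 => ->; case: eqP.
Qed.

(** After exchanging the two sums, each index [i] contributes only at the single listed root
    [x = r i], hence exactly once if that root lies in [I]. *)
Lemma eig_count_prod (R : rcfType) n (A : 'M[R]_n) (r : 'I_n -> R)
    (I : interval R) :
  char_poly A = \prod_i ('X - (r i)%:P) ->
  eig_count A I = #|[set i | r i \in I]|.
Proof.
move=> cA; rewrite /eig_count.
have c0 : char_poly A != 0 by rewrite monic_neq0 ?char_poly_monic.
under eq_bigr do rewrite cA mup_prod_XsubC.
rewrite exchange_big /= -sum1dep_card [RHS]big_mkcond /=.
apply: eq_bigr => i _.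
have ri : r i \in rootsR (char_poly A).
  rewrite -roots_on_rootsR // inE /= cA.
  by rewrite (bigD1 i) //= rootM root_XsubC eqxx.
rewrite big_mkcond (bigD1_seq (r i)) ?uniq_roots //= eqxx big1 ?addn0 // => x.
by rewrite eq_sym => /negbTE->; case: ifP.
Qed.

(** Over [R[i]] a real symmetric matrix is Hermitian, so it is unitarily diagonalizable with a real
    diagonal, which descends to [r]. *)
Lemma symmetric_spectral (R : rcfType) n (A : 'M[R]_n) :
  A^T = A ->
  exists P : 'M[R[i]]_n, exists2 r : 'I_n -> R,
    P \is unitarymx &
    map_mx (real_complex R) A =
      P ^t* *m diag_mx (\row_i (r i)%:C%C) *m P.
Proof.
move=> sA; set B := map_mx _ A.
have hB : B \is hermsymmx.
  apply: realsym_hermsym.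
    apply/is_hermitianmxP; rewrite expr0 scale1r map_mx_id //.
    by rewrite /B map_trmx sA.
  by apply/mxOverP => i j; rewrite mxE complex_real.
have /mxOverP rD := hermitian_spectral_diag_real hB.
exists (spectralmx B), (fun i => complex.Re (spectral_diag B 0 i)).
  exact: spectral_unitarymx.
have /orthomx_spectralP {1}-> := hermitian_normalmx hB.
rewrite invmx_unitary ?spectral_unitarymx //; congr (_ *m diag_mx _ *m _).
by apply/rowP => i; rewrite mxE RRe_real.
Qed.

(** From [Q *m T = 1] the scalar matrix ['X] equals [Q *m 'X *m T], so the characteristic matrix
    factors and the outer determinants cancel. *)
Lemma char_poly_conj (K : comNzRingType) n (Q D T : 'M[K]_n) :
  Q *m T = 1%:M -> char_poly (Q *m D *m T) = char_poly D.
Proof.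
move=> QT; rewrite /char_poly /char_poly_mx !map_mxM.
have QT' : map_mx polyC Q *m map_mx polyC T = 1%:M.
  by rewrite -map_mxM QT map_mx1.
rewrite -[in LHS](scalemx1 _ 'X) -QT' scalemxAl -mul_mx_scalar.
rewrite -mulmxBl -mulmxBr.
by rewrite !det_mulmx mulrAC -det_mulmx QT' det1 mul1r.
Qed.

Lemma symmetric_char_poly (R : rcfType) n (A : 'M[R]_n) (P : 'M[R[i]]_n)
    (r : 'I_n -> R) :
  P \is unitarymx ->
  map_mx (real_complex R) A = P ^t* *m diag_mx (\row_i (r i)%:C%C) *m P ->
  char_poly A = \prod_i ('X - (r i)%:P).
Proof.
move=> uP eA; apply: (@map_poly_inj _ _ (real_complex R)).
rewrite map_char_poly eA rmorph_prod /= char_poly_conj; last first.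
  by rewrite -invmx_unitary // mulVmx // unitarymx_unit.
rewrite char_poly_trig ?diag_mx_is_trig //; apply: eq_bigr => i _.
by rewrite rmorphB /= map_polyX map_polyC !mxE eqxx mulr1n.
Qed.

(** * Rank bounds, and eigenvalue counts from quadratic forms *)

Lemma mxrank_diag_le (F : fieldType) n (d : 'rV[F]_n) :
  (\rank (diag_mx d) <= #|[set i | d 0 i != 0]%R|)%N.
Proof.
set S := [set i | _].
have -> : diag_mx d = \sum_(i in S) d 0 i *: delta_mx i i.
  apply/matrixP => i j; rewrite summxE mxE.
  case: (boolP (i \in S)) => iS.
    rewrite (bigD1 i) //= big1 ?addr0 => [|k /andP[_ ki]]; rewrite !mxE.
      by rewrite eqxx (eq_sym j); case: eqP; rewrite ?mulr1 ?mulr0.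
    by rewrite eq_sym (negbTE ki) mulr0.
  rewrite big1 => [|k kS].
    by move: iS; rewrite inE negbK => /eqP->; rewrite mul0rn.
  rewrite !mxE; case: eqP => [e|]; last by rewrite mulr0.
  by rewrite e kS in iS.
rewrite -sum1_card.
elim/big_ind2: _ => [|M k N l Mk Nl|i _]; first by rewrite mxrank0.
  by rewrite (leq_trans (mxrank_add _ _)) // leq_add.
by rewrite (leq_trans (mxrank_scale _ _)) // mxrank_delta.
Qed.

Lemma mxrank_row_mx_le (F : fieldType) m n1 n2 (A : 'M[F]_(m, n1))
    (B : 'M[F]_(m, n2)) :
  (\rank (row_mx A B) <= \rank A + \rank B)%N.
Proof.
rewrite -mxrank_tr tr_row_mx -addsmxE.
by rewrite (leq_trans (mxrank_adds_leqif _ _).1) // !mxrank_tr.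
Qed.

(* The Courant-Fischer principle: the constraints [x *m B = 0] cut out a space
   of dimension at least [n - \rank B] on which the form dominates [a]. *)
Lemma eig_count_ge_quadratic (R : rcfType) n m (A : 'M[R]_n)
    (B : 'M[R[i]]_(n, m)) (a : R) :
  A^T = A ->
  (forall x : 'rV[R[i]]_n, x *m B = 0 ->
     a%:C%C * \sum_i `|x 0 i| ^+ 2 <=
       (x *m map_mx (real_complex R) A *m x ^t*) 0 0) ->
  (n - \rank B <= eig_count A `[a, +oo[)%N.
Proof.
move=> sA qA; have [P [r uP eA]] := symmetric_spectral sA.
rewrite (eig_count_prod _ (symmetric_char_poly uP eA)).
set S := [set i | _].
pose d : 'rV[R[i]]_n := \row_i (i \in S)%:R.
(* If fewer than [n - \rank B] eigenvalues are [>= a], then requiring also that the coordinates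
   along their eigenvectors vanish keeps the rank below [n], so some nonzero [x] meets all
   constraints. *)
pose B' := row_mx B (P ^t* *m diag_mx d).
rewrite leqNgt; apply/negP => lt.
have rkB' : (\rank B' < n)%N.
  apply: (@leq_ltn_trans (\rank B + #|S|)); last by rewrite -ltn_subRL.
  rewrite (leq_trans (mxrank_row_mx_le _ _)) // leq_add2l.
  rewrite (leq_trans (mxrankM_maxr _ _)) // (leq_trans (mxrank_diag_le _)) //.
  apply: subset_leq_card; apply/subsetP => i; rewrite inE mxE.
  by case: (i \in S); rewrite ?eqxx.
have /rowV0Pn[x /sub_kermxP xB' x0] : kermx B' != 0.
  by rewrite -mxrank_eq0 mxrank_ker subn_eq0 -ltnNge.
move: xB'; rewrite mul_mx_row -[RHS]row_mx0 => /eq_row_mx[xB xP].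
have := qA x xB; rewrite eA.
pose y := x *m P ^t*.
have -> : x *m (P ^t* *m diag_mx (\row_i (r i)%:C%C) *m P) *m x ^t* =
    y *m diag_mx (\row_i (r i)%:C%C) *m y ^t*.
  by rewrite /y trmx_mul map_mxM trmxCK !mulmxA.
have sumsq (z : 'rV[R[i]]_n) : \sum_i `|z 0 i| ^+ 2 = (z *m z ^t*) 0 0.
  by rewrite mxE; apply: eq_bigr => i _; rewrite !mxE normCK.
have yx : y *m y ^t* = x *m x ^t*.
  rewrite /y trmx_mul map_mxM trmxCK mulmxA -(mulmxA x).
  by rewrite -invmx_unitary // mulVmx ?unitarymx_unit // mulmx1.
(* The coordinates [y] have the norm of [x] and live only where [r j < a], which gives the strict
   opposite inequality. *)
rewrite sumsq -yx -sumsq mxE mulr_sumr; apply/negP; rewrite lt_geF //.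
have yS i : i \in S -> y 0 i = 0.
  move=> iS; move/rowP/(_ i): xP.
  by rewrite mulmxA mul_mx_diag !mxE iS mulr1.
have /rV0Pn[i yi] : y != 0.
  apply: contraNneq x0 => y0.
  rewrite -[x]mulmx1 -(mulVmx (unitarymx_unit uP)) invmx_unitary //.
  by rewrite mulmxA -/y y0 mul0mx.
have termE j : (y *m diag_mx (\row_i (r i)%:C%C)) 0 j * (y ^t*) j 0 =
    (r j)%:C%C * `|y 0 j| ^+ 2.
  by rewrite mul_mx_diag !mxE normCK mulrAC mulrC.
under eq_bigr do rewrite termE.
have small j : y 0 j != 0 -> r j < a.
  apply: contraNT; rewrite -leNgt => aj; apply/eqP/yS.
  by rewrite inE in_itv /= aj.
rewrite [ltLHS](bigD1 i) // [ltRHS](bigD1 i) //= ltr_leD //.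
  by rewrite ltr_pM2r ?ltcR ?small // exprn_gt0 ?normr_gt0.
apply: ler_sum => j _; have [->|yj] := eqVneq (y 0 j) 0.
  by rewrite normr0 expr0n !mulr0.
by rewrite ler_wpM2r ?exprn_ge0 // lecR ltW ?small.
Qed.

Lemma eig_countT (R : rcfType) n (A : 'M[R]_n) :
  A^T = A -> eig_count A `]-oo, +oo[ = n.
Proof.
move=> sA; have [P [r uP eA]] := symmetric_spectral sA.
rewrite (eig_count_prod _ (symmetric_char_poly uP eA)) -[RHS]card_ord.
by apply: eq_card => i; rewrite !inE.
Qed.

Lemma eig_count_gt0 (R : rcfType) n (A : 'M[R]_n) (I : interval R) (a : R) :
  eigenvalue A a -> a \in I -> (0 < eig_count A I)%N.
Proof.
rewrite eigenvalue_root_char => ra aI.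
have c0 : char_poly A != 0 by rewrite monic_neq0 ?char_poly_monic.
rewrite /eig_count (big_rem a) /=; last by rewrite -roots_on_rootsR // inE.
by rewrite aI addn_gt0 mup_geq // expr1 dvdp_XsubCl ra.
Qed.

Lemma eig_count_split3 (R : rcfType) n (A : 'M[R]_n) (a b : R) : a <= b ->
  (eig_count A `]-oo, +oo[ =
     eig_count A `]-oo, a[ + eig_count A `[a, b[ + eig_count A `[b, +oo[)%N.
Proof.
move=> ab; rewrite /eig_count; elim: (rootsR _) => [|x s IHs].
  by rewrite !big_nil.
rewrite !big_cons !in_itv /= IHs.
have [xa|ax] := ltP x a; have [xb|bx] := ltP x b; rewrite /= ?addnA //.
- by move: (lt_le_trans xa ab); rewrite ltNge bx.
- by rewrite -!addnA addnCA.
- by rewrite -!addnA addnCA (addnCA (mup _ _)).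
Qed.

(** * Quadratic forms of weighted Laplacians *)

Section Laplacian.
Variables (C : numClosedFieldType) (n : nat).
Implicit Type x : 'rV[C]_n.

(** The factor 2 appears because the right-hand sum runs over ordered pairs. *)
Lemma laplacian_quadratic (W : 'M[C]_n) x : W^T = W ->
  (x *m (diag_mx (\row_v \sum_u W u v) - W) *m x ^t*) 0 0 *+ 2 =
  \sum_u \sum_v W u v * `|x 0 u - x 0 v| ^+ 2.
Proof.
move=> /matrixP sW.
have WC u v : W v u = W u v by rewrite -[in LHS]sW mxE.
have -> : (x *m (diag_mx (\row_v \sum_u W u v) - W) *m x ^t*) 0 0 =
    \sum_u \sum_v W u v * (x 0 v * (x 0 v)^* - x 0 u * (x 0 v)^*).
  rewrite exchange_big mxE; apply: eq_bigr => v _ /=.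
  rewrite mulmxBr mul_mx_diag !mxE mulrBl mulr_sumr !mulr_suml -sumrB.
  by apply: eq_bigr => u _; ring.
(* Adding the copy with [u] and [v] exchanged completes the square, by symmetry of [W]. *)
rewrite mulr2n {2}exchange_big -big_split; apply: eq_bigr => u _ /=.
rewrite -big_split; apply: eq_bigr => v _ /=.
by rewrite [W v u]WC normCK rmorphB /=; ring.
Qed.

(** When the squares are expanded, the cross terms factor through the sum of [x] over [S], which is
    zero. *)
Lemma sum_sqr_dist (S : {set 'I_n}) x : \sum_(u in S) x 0 u = 0 ->
  \sum_(u in S) \sum_(v in S) `|x 0 u - x 0 v| ^+ 2 =
  (#|S|%:R * \sum_(u in S) `|x 0 u| ^+ 2) *+ 2.
Proof.
move=> x0.
have x0C : \sum_(u in S) (x 0 u)^* = 0 by rewrite -rmorph_sum x0 rmorph0.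
have sumE u : \sum_(v in S) `|x 0 u - x 0 v| ^+ 2 =
    #|S|%:R * `|x 0 u| ^+ 2 + \sum_(v in S) `|x 0 v| ^+ 2.
  transitivity (\sum_(v in S) (`|x 0 u| ^+ 2 + `|x 0 v| ^+ 2
      - (x 0 u * (x 0 v)^* + (x 0 u)^* * x 0 v))).
    by apply: eq_bigr => v _; rewrite !normCK rmorphB /=; ring.
  rewrite sumrB !big_split /= sumr_const mulr_natl.
  by rewrite -[X in _ - (X + _)]mulr_sumr -[X in _ - (_ + X)]mulr_sumr x0 x0C
    !mulr0 addr0 subr0.
under eq_bigr do rewrite sumE.
by rewrite big_split /= sumr_const -mulr_sumr mulr2n mulr_natl.
Qed.

(* The weights dominate those of K_n plus the clique on [P]; on vectors of sum
   zero supported in [P] both of these act as scalars, namely [n] and [#|P|]. *)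
Lemma laplacian_quadratic_ge (W : 'M[C]_n) (P : {set 'I_n}) x : W^T = W ->
  (forall u v, u != v -> (1 + ((u \in P) && (v \in P)))%:R <= W u v) ->
  \sum_u x 0 u = 0 -> (forall u, u \notin P -> x 0 u = 0) ->
  (n + #|P|)%:R * \sum_u `|x 0 u| ^+ 2 <=
    (x *m (diag_mx (\row_v \sum_u W u v) - W) *m x ^t*) 0 0.
Proof.
move=> sW geW x0 xP.
have sumP (F : 'I_n -> C) : (forall u, u \notin P -> F u = 0) ->
    \sum_(u in P) F u = \sum_u F u.
  by move=> F0; rewrite [RHS](bigID (mem P)) /= [X in _ + X]big1 ?addr0.
have inT (F : 'I_n -> C) : \sum_(u in [set: 'I_n]) F u = \sum_u F u.
  by apply: eq_bigl => u; rewrite inE.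
rewrite -(@ler_pMn2r _ 2) // laplacian_quadratic //.
have sT : \sum_u \sum_v `|x 0 u - x 0 v| ^+ 2 =
    (n%:R * \sum_u `|x 0 u| ^+ 2) *+ 2.
  have := @sum_sqr_dist setT x; rewrite !inT cardsT card_ord => <- //.
  by apply: eq_bigr => u _; rewrite inT.
have sP : \sum_(u in P) \sum_(v in P) `|x 0 u - x 0 v| ^+ 2 =
    (#|P|%:R * \sum_u `|x 0 u| ^+ 2) *+ 2.
  by rewrite sum_sqr_dist ?sumP // => u /xP->; rewrite normr0 expr0n.
rewrite natrD mulrDl mulrnDl -sP -sT [X in _ + X <= _]big_mkcond -big_split /=.
apply: ler_sum => u _.
(* Indicator weights extend the clique sum to all pairs, so that the comparison can be made pair by
   pair. *)
have -> : (if u \in P then \sum_(v in P) `|x 0 u - x 0 v| ^+ 2 else 0) =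
    \sum_v ((u \in P) && (v \in P))%:R * `|x 0 u - x 0 v| ^+ 2.
  case: ifP => uP; last by rewrite big1 // => v _; rewrite mul0r.
  rewrite big_mkcond; apply: eq_bigr => v _.
  by case: (v \in P); rewrite ?mul1r ?mul0r.
rewrite -big_split /=; apply: ler_sum => v _.
have [->|uv] := eqVneq u v; first by rewrite subrr normr0 expr0n !mulr0 addr0.
rewrite -{1}[_ ^+ 2]mul1r -mulrDl ler_wpM2r ?exprn_ge0 //.
by have := geW u v uv; rewrite natrD.
Qed.

End Laplacian.

(** * Distances, pendant vertices and stars *)

Section Distances.
Variables (n : nat) (G : sgraph n).
Hypothesis connG : connected G.

(** Reversing a shortest walk from [v] to [u] gives a walk from [u] to [v] of the same length. *)
Lemma gdist_le_sym u v : (gdist G u v <= gdist G v u)%N.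
Proof.
have [/existsP[w /andP[pw /eqP lw]] _] := gdistP (connG v u).
have [_] := gdistP (connG u v).
move=> /(_ (rev (belast v w))); rewrite size_rev size_belast size_tuple; apply.
  rewrite -{1}lw rev_path; apply: sub_path pw => a b /=.
  by rewrite adj_sym.
by case: (tval w) lw => [<-|a s] //= _; rewrite rev_cons last_rcons.
Qed.

Lemma gdist_sym u v : gdist G u v = gdist G v u.
Proof. by apply/eqP; rewrite eqn_leq !gdist_le_sym. Qed.

Lemma gdist_gt0 u v : u != v -> (0 < gdist G u v)%N.
Proof.
move=> uv; have [/existsP[w /andP[_ lw]] _] := gdistP (connG u v).
rewrite lt0n; apply: contraNneq uv => d0.
have := size_tuple w; rewrite {2}d0 => /size0nil w0.
by move: lw; rewrite w0.
Qed.

Lemma gdist_gt1 u v : u != v -> ~~ adj G u v -> (1 < gdist G u v)%N.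
Proof.
move=> uv; have [/existsP[w /andP[pw lw]] _] := gdistP (connG u v).
rewrite ltn_neqAle gdist_gt0 // andbT; apply: contraNneq => d1.
have := size_tuple w; rewrite -{2}d1.
case: (tval w) pw lw => [|a [|b s]] //= /andP[ua _] /eqP <- _.
exact: ua.
Qed.

Lemma gdist_adj u v : adj G u v -> gdist G u v = 1%N.
Proof.
move=> uv; apply/eqP; rewrite eqn_leq gdist_gt0 ?andbT; last first.
  by apply: contraTneq uv => ->; rewrite adj_irr.
have [_ /(_ [:: v])] := gdistP (connG u v); apply=> //=.
by rewrite uv.
Qed.

Lemma pendant_adj_unique u v w : u \in pendant G ->
  adj G u v -> adj G u w -> v = w.
Proof.
rewrite inE => /cards1P[a Na] uv uw.
have: v \in [set w | adj G u w] by rewrite inE.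
have: w \in [set w | adj G u w] by rewrite inE.
by rewrite Na !inE => /eqP-> /eqP->.
Qed.

Lemma graph_iso_complete :
  (forall u v, u != v -> adj G u v) -> graph_iso G (complete_graph n).
Proof.
move=> allG; exists id => [|u v /=]; first by exists id.
rewrite /complete_adj; have [->|/allG-> //] := eqVneq u v.
by rewrite adj_irr.
Qed.

(* Two adjacent pendant vertices form a whole component, so G would be K_2. *)
Lemma pendant_nonadj u v : ~ graph_iso G (complete_graph n) ->
  u \in pendant G -> v \in pendant G -> ~~ adj G u v.
Proof.
move=> GnK pu pv; apply/negP => uv; apply: GnK; apply: graph_iso_complete.
have vu : adj G v u by rewrite adj_sym.
have cl : closed (adj G) [set u; v].
  apply: intro_closed => [|a b ab]; first by exact/sym_connect_sym/adj_sym.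
  rewrite !inE => /orP[] /eqP ea; rewrite ea in ab.
    by rewrite (pendant_adj_unique pu ab uv) eqxx orbT.
  by rewrite (pendant_adj_unique pv ab vu) eqxx.
have all2 a : a \in [set u; v].
  by rewrite -(closed_connect cl (connG u a)) !inE eqxx.
move=> a b; have := all2 a; have := all2 b; rewrite !inE.
by move=> /orP[] /eqP-> /orP[] /eqP->; rewrite ?eqxx.
Qed.

(** The centre [c] is the only vertex that is not pendant: the neighbour of a pendant vertex cannot
    be pendant, so it is [c]. *)
Lemma pendants_star : (0 < n)%N -> ~ graph_iso G (complete_graph n) ->
  #|pendant G| = (n - 1)%N ->
  exists c : 'I_n, forall u v, adj G u v = ((u == c) != (v == c)).
Proof.
move=> n0 GnK cP.
have /cards1P[c Pc] : #|~: pendant G| == 1%N.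
  by rewrite cardsCs setCK card_ord cP subKn.
have inP u : (u \in pendant G) = (u != c).
  by have := in_setC u (pendant G); rewrite Pc inE => ->; rewrite negbK.
have toc u : u != c -> adj G u c.
  rewrite -inP => pu; have := pu; rewrite inE => /cards1P[v Nu].
  have uv : adj G u v by have := set11 v; rewrite -Nu inE.
  have [<-//|] := eqVneq v c; rewrite -inP => pv.
  by rewrite (negbTE (pendant_nonadj GnK pu pv)) in uv.
exists c => u v; have [->|uc] := eqVneq u c; have [->|vc] := eqVneq v c.
- by rewrite adj_irr.
- by rewrite adj_sym toc.
- by rewrite toc.
- by apply/negbTE/pendant_nonadj; rewrite ?inP.
Qed.

Lemma star_graph_iso (c : 'I_n) :
  (forall u v, adj G u v = ((u == c) != (v == c))) ->
  graph_iso G (star_graph n).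
Proof.
move=> adjE; have n0 : (0 < n)%N by apply: leq_ltn_trans (ltn_ord c).
(* The transposition of [c] and vertex 0 moves the centre to the place that [star_adj]
   prescribes. *)
pose z := Ordinal n0; have tz u : (val (tperm c z u) == 0%N) = (u == c).
  by rewrite -(inj_eq (@perm_inj _ (tperm c z))) tpermL.
exists (tperm c z) => [|u v]; last by rewrite /= /star_adj !tz adjE.
by exists (tperm c z) => u; rewrite tpermK.
Qed.

(** * Spectrum and quadratic form of the distance Laplacian *)

Section DistanceLaplacian.
Variable R : rcfType.

Lemma dist_mx_sym (K : pzRingType) : (dist_mx G K)^T = dist_mx G K.
Proof. by apply/matrixP => u v; rewrite !mxE gdist_sym. Qed.

Lemma distL_mx_sym : (distL_mx G R)^T = distL_mx G R.
Proof. by rewrite linearB /= tr_diag_mx dist_mx_sym. Qed.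

(** Exhibits the matrix over [R[i]] as the Laplacian weighted by distances, the shape that
    [laplacian_quadratic_ge] expects. *)
Lemma map_distL_mx : map_mx (real_complex R) (distL_mx G R) =
  diag_mx (\row_v \sum_u dist_mx G R[i] u v) - dist_mx G R[i].
Proof.
apply/matrixP => u v; rewrite !mxE rmorphB rmorphMn /= !rmorph_nat natr_sum.
by congr (_ *+ _ - _); apply: eq_bigr => w _; rewrite mxE.
Qed.

Lemma const_mul_distL : const_mx 1 *m distL_mx G R = 0 :> 'rV_n.
Proof.
apply/rowP => v; rewrite mulmxBr mul_mx_diag !mxE mul1r natr_sum -sumrB.
by rewrite big1 // => u _; rewrite !mxE mul1r subrr.
Qed.

Lemma eigenvalue_distL0 : (0 < n)%N -> eigenvalue (distL_mx G R) 0.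
Proof.
move=> n0; apply/eigenvalueP; exists (const_mx 1).
  by rewrite const_mul_distL scale0r.
by apply/rV0Pn; exists (Ordinal n0); rewrite mxE oner_neq0.
Qed.

(* Row [c] of the matrix is [n e_c - 1], and the vector 1 is in the kernel, so
   row [c] is an eigenvector. *)
Lemma eigenvalue_distL_dominating (c : 'I_n) : (1 < n)%N ->
  (forall v, v != c -> adj G c v) -> eigenvalue (distL_mx G R) n%:R.
Proof.
move=> n1 domc; apply/eigenvalueP.
pose x : 'rV[R]_n := n%:R *: delta_mx 0 c - const_mx 1.
have dc v : gdist G c v = (v != c) :> nat.
  have [->|vc] := eqVneq v c; last by rewrite gdist_adj ?domc.
  apply/eqP; rewrite -leqn0.
  by have [_ /(_ [::])] := gdistP (connG c c); apply.
have Tc : transmission G c = (n - 1)%N.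
  rewrite /transmission (bigD1 c) //= dc eqxx add0n.
  under eq_bigr => u uc do rewrite gdist_sym dc uc.
  by rewrite sum1_card cardC1 card_ord subn1.
have rowc : row c (distL_mx G R) = x.
  apply/rowP => v; rewrite !mxE dc eqxx /= eq_sym.
  have [_|_] := eqVneq v c; last by rewrite mulr0n mulr0.
  by rewrite Tc mulr1n mulr1 subr0 natrB // ltnW.
exists x.
  by rewrite {1}/x mulmxBl const_mul_distL subr0 -scalemxAl -rowE rowc.
apply/rV0Pn; exists c; rewrite !mxE !eqxx mulr1.
by rewrite subr_eq0 pnatr_eq1 gtn_eqF.
Qed.

Lemma distL_quadratic_ge (x : 'rV[R[i]]_n) :
  ~ graph_iso G (complete_graph n) ->
  \sum_u x 0 u = 0 -> (forall u, u \notin pendant G -> x 0 u = 0) ->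
  (n + #|pendant G|)%:R * \sum_u `|x 0 u| ^+ 2 <=
    (x *m map_mx (real_complex R) (distL_mx G R) *m x ^t*) 0 0.
Proof.
move=> GnK x0 xP; rewrite map_distL_mx.
apply: laplacian_quadratic_ge (dist_mx_sym _) _ x0 xP => u v uv.
rewrite mxE ler_nat.
case: andP => [[uP vP]|_]; last by rewrite addn0 gdist_gt0.
by rewrite gdist_gt1 ?pendant_nonadj.
Qed.

End DistanceLaplacian.

End Distances.

Local Close Scope sesquilinear_scope.

Theorem theorem2p12 (R : rcfType) (n p : nat) (G : sgraph n)
    (connG : connected G)
    (GnK : ~ graph_iso G (complete_graph n))
    (p_ge1 : (1 <= p)%N)
    (cardP : #|pendant G| = p) :
  (eig_count (distL_mx G R) `[n%:R, (n + p)%:R[ <= n - p)%N /\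
  (p = (n - 1)%N ->
     (eig_count (distL_mx G R) `[n%:R, (n + p)%:R[ = (n - p)%N <->
      graph_iso G (star_graph n))).
Proof.
set A := distL_mx G R.
have pn : (p <= n)%N by rewrite -cardP -[leqRHS]card_ord max_card.
have n0 : (0 < n)%N by apply: leq_trans pn.
have sA : A^T = A := distL_mx_sym connG R.
have low : (0 < eig_count A `]-oo, n%:R[)%N.
  apply: eig_count_gt0 (eigenvalue_distL0 G R n0) _.
  by rewrite in_itv /= ltr0n.
pose notP : 'rV[R[i]]_n := \row_v (v \notin pendant G)%:R.
(* The equation [x *m B = 0] says that [x] has sum zero and is supported on the pendant vertices;
   the rank of [B] is at most [1 + (n - p)], whence the bound [p - 1]. *)
pose B : 'M[R[i]]_(n, 1 + n) := row_mx (const_mx 1) (diag_mx notP).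
have high : (p - 1 <= eig_count A `[(n + p)%:R, +oo[)%N.
  apply: leq_trans (eig_count_ge_quadratic (B := B) sA _).
    have rkB : (\rank B <= 1 + (n - p))%N.
      rewrite (leq_trans (mxrank_row_mx_le _ _)) // leq_add ?rank_leq_col //.
      rewrite (leq_trans (mxrank_diag_le _)) //.
      have -> : (n - p)%N = #|~: pendant G|.
        by rewrite cardsCs setCK card_ord cardP.
      apply/subset_leq_card/subsetP => v; rewrite in_setC inE mxE.
      by case: (v \in pendant G); rewrite ?eqxx.
    lia.
  move=> x; rewrite mul_mx_row -[RHS]row_mx0 => /eq_row_mx[x1 xP].
  rewrite rmorph_nat -{1}cardP; apply: distL_quadratic_ge => // [|u uP].
    move/rowP/(_ 0): x1; rewrite !mxE => {2}<-.
    by apply: eq_bigr => u _; rewrite mxE mulr1.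
  by move/rowP/(_ u): xP; rewrite mul_mx_diag !mxE uP mulr1.
(* Of the [n] eigenvalues, at least one lies below [n] and at least [p - 1] are [>= n + p]. *)
have ub : (eig_count A `[n%:R, (n + p)%:R[ <= n - p)%N.
  have := eig_countT sA.
  rewrite (@eig_count_split3 _ _ _ n%:R (n + p)%:R) ?ler_nat ?leq_addr //.
  move=> countE; rewrite leq_subRL // -[leqRHS]countE addnAC leq_add2r.
  by rewrite -[leqLHS](subnKC p_ge1) leq_add.
split=> // pn1; rewrite pn1 in cardP.
have [c adjE] := pendants_star connG n0 GnK cardP.
split=> [_|_]; first exact: star_graph_iso adjE.
(* Here [n - p = 1], so a single eigenvalue in the interval suffices: [n] itself, since the centre
   dominates. *)
apply/eqP; rewrite eqn_leq ub pn1 subKn //.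
apply: eig_count_gt0 (eigenvalue_distL_dominating connG R (c := c) _ _) _.
- lia.
- by move=> v vc; rewrite adjE eqxx (negbTE vc).
- by rewrite in_itv /= lexx ltr_nat; lia.
Qed.
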